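(* For every integer $n\ge 2$, the power graph of the generalized quaternion group $Q_{4n}$ satisfies $$\mathrm{sdim}(\Gamma_{Q_{4n}})=4n-(\sigma_{2n}+1).$$
   Context: The power graph $\Gamma_G$ of a finite group $G$ has vertex set $G$, and two distinct elements are adjacent if one is a power of the other. For vertices $x,y,z$ of a graph $\Gamma$, the vertex $z$ strongly resolves $x$ and $y$ if there exists a shortest path from $z$ to $x$ containing $y$, or a shortest path from $z$ to $y$ containing $x$. A subset $S$ of $V(\Gamma)$ is a strong resolving set if every pair of (distinct) vertices of $\Gamma$ is strongly resolved by some vertex of $S$. The strong metric dimension $\mathrm{sdim}(\Gamma)$ is the smallest cardinality of a strong resolving set of $\Gamma$. The generalized quaternion group (of order $4n$) is $Q_{4n}=\langle x,y: x^n=y^2,\ x^{2n}=1,\ y^{-1}xy=x^{-1}\rangle$, for $n\ge 2$. For $k=p_1^{r_1}\cdots p_m^{r_m}$ with distinct primes $p_i$, $m\ge1$, $r_i\ge 1$, set $\sigma_k=1$ if $m=1$ and $\sigma_k=\sum_{i=1}^m r_i$ if $m\ge 2$. *)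

(* Defs.v *)
From mathcomp Require Import all_boot all_fingroup all_solvable.
From mathcomp Require Import boolp.

Set Implicit Arguments.
Unset Strict Implicit.
Unset Printing Implicit Defensive.

Local Open Scope group_scope.

(* A graph on a finite vertex type [T] is given by its adjacency [e : rel T];
   a path [x :: p] is represented as in [path.v] by [x] and [p]. *)

Definition shortest_path (T : finType) (e : rel T) (x y : T) (p : seq T) : Prop :=
  [/\ path e x p, last x p = y
    & forall q : seq T, path e x q -> last x q = y -> size p <= size q].

Definition strongly_resolves (T : finType) (e : rel T) (z x y : T) : Prop :=
  (exists2 p : seq T, shortest_path e z x p & y \in z :: p) \/
  (exists2 p : seq T, shortest_path e z y p & x \in z :: p).

Definition strong_resolving_set (T : finType) (e : rel T) (S : {set T}) : Prop :=
  forall x y : T, x != y -> exists2 z : T, z \in S & strongly_resolves e z x y.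

(* The whole vertex set is a strong resolving set of every connected graph, so
   the minimum below is then over a nonempty family. On a disconnected graph
   there is no strong resolving set and the value is meaningless; power graphs
   are connected, since 1 is adjacent to every other vertex. *)
Definition sdim (T : finType) (e : rel T) : nat :=
  #|[arg min_(S < [set: T] | `[< strong_resolving_set e S >]) #|S| ]|.

(* [u \in <[v]>] says that [u] is a power of [v] (lemma [cycleP]). *)
Definition power_graph (gT : finGroupType) : rel gT :=
  fun u v => (u != v) && ((u \in <[v]>) || (v \in <[u]>)).

(* [gT] is the group of order 4n with this presentation, up to isomorphism;
   [x ^ y] is the conjugate [y^-1 * x * y]. The library's ['Q_m] is intended for
   [m] a power of 2, and ['Q_(4 * n)] has the wrong order when [n] is odd. *)
Definition generalized_quaternion (n : nat) (gT : finGroupType) : Prop :=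
  [set: gT] \isog
    Grp (x : y : x ^+ n = y ^+ 2, x ^+ (2 * n) = 1, x ^ y = x^-1).

(* [primes k] lists the distinct prime divisors of [k], and [logn p k] is the
   exponent of [p] in [k]; only used for [k > 1]. *)
Definition sigma (k : nat) : nat :=
  if size (primes k) == 1%N then 1%N else \sum_(p <- primes k) logn p k.

(* Main.v *)
Require Import Defs.
From mathcomp Require Import all_boot all_fingroup all_algebra all_solvable.
From mathcomp Require Import boolp.

(** In a graph with a vertex adjacent to all others, geodesics have at most two
    edges, so a third vertex resolves [u] and [v] only if it is a neighbour of
    exactly one of them and [u], [v] are adjacent. Hence [S] is a strong
    resolving set if and only if its complement is a clique whose members have
    pairwise distinct closed neighbourhoods ([strong_resolving_setP]), and the
    strong metric dimension is the order of the graph minus the largest size of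
    such a reduced clique ([sdimE]).

    In a power graph, adjacent elements of equal order generate the same cyclic
    subgroup and so have the same closed neighbourhood. Along a reduced clique
    the orders are therefore strictly increasing for divisibility, and the number
    of prime factors of the order, counted with multiplicity, is injective on it
    ([card_reduced_clique]). In [Q_4n] every order divides [2n] or equals 4, and
    both [2n] and 4 have at most [bigomega (2 * n)] prime factors, so a reduced
    clique has at most [bigomega (2 * n) + 1] members.

    If [2n] is not a prime power this bound is attained: a maximal chain of
    subgroups of the cyclic subgroup [<[x]>] of order [2n] has the right length,
    and generators of its members have distinct closed neighbourhoods: an element
    outside [<[x]>] separates [1] from a generator of [<[x]>], and for any other
    two members some divisor of [2n] is comparable with only one of their orders
    ([separating_divisor]).

    If [2n] is a prime power then [Q_4n] is a 2-group with a unique involution,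
    which lies in every nontrivial cyclic subgroup: the closed neighbourhoods
    of [1] and of the involution are the whole group, while those of two adjacent
    elements of order greater than 2 coincide. So a reduced clique has at most
    two members, as [{1, x}] has.

    The presentation enters through [quaternion_structure]: a permutation group
    with at least [4n] elements satisfies the relations, so nothing collapses. *)

Set Implicit Arguments.
Unset Strict Implicit.
Unset Printing Implicit Defensive.

(** * Strong resolving sets in a graph with a dominating vertex *)

Section StrongResolving.

Variables (T : finType) (e : rel T).

Definition closed_nbhd (u : T) : {set T} := [set v | (v == u) || e u v].

Definition reduced_clique (C : {set T}) : Prop :=
  {in C &, forall u v, u != v -> e u v && (closed_nbhd u != closed_nbhd v)}.

Variable c : T.
Hypothesis e_irr : irreflexive e.
Hypothesis e_sym : symmetric e.
Hypothesis e_dom : forall v, v != c -> e c v.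

Lemma exists_shortest_path x y :
  x != y -> exists2 p, shortest_path e x y p & size p <= 2.
Proof.
move=> nxy; have [exy | nexy] := boolP (e x y).
  exists [:: y] => //; split=> //=; first by rewrite exy.
  by case=> [|a q] //= _ exy'; rewrite exy' eqxx in nxy.
have xc: x != c.
  by apply/eqP => xc; case/negP: nexy; rewrite xc e_dom // -xc eq_sym.
have yc: y != c by apply/eqP => yc; case/negP: nexy; rewrite yc e_sym e_dom -?yc.
exists [:: c; y] => //; split=> //=; first by rewrite e_sym !e_dom.
case=> [|a [|b q]] //=; first by move=> _ exy; rewrite exy eqxx in nxy.
by rewrite andbT => exa ay; rewrite -ay exa in nexy.
Qed.

Lemma strongly_resolves_self x y : x != y -> strongly_resolves e x x y.
Proof.
move=> nxy; right; have [p p_short _] := exists_shortest_path nxy.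
by exists p => //; rewrite mem_head.
Qed.

(** An inner vertex of a geodesic with at most two edges is its midpoint. *)
Lemma shortest_path_midpoint z x y :
    y != z -> y != x -> z != x ->
  (exists2 p, shortest_path e z x p & y \in z :: p) <->
  [/\ e z y, e y x & ~~ e z x].
Proof.
move=> nyz nyx nzx; split=> [[p [zp lp minp]] | [ezy eyx nezx]].
  have [q [zq lq _] sq] := exists_shortest_path nzx.
  have {q zq lq sq} := leq_trans (minp q zq lq) sq.
  case: p => [|a [|b [|//]]] /= in zp lp minp *.
  - by rewrite lp eqxx in nzx.
  - by rewrite lp !inE (negPf nyz) (negPf nyx).
  rewrite lp !inE (negPf nyz) (negPf nyx) orbF /= in zp * => _ /eqP->.
  case/and3P: zp => -> -> _; split=> //; apply/negP => ezx.
  by have /= := minp [:: x]; rewrite ezx; move/(_ isT erefl).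
exists [:: y; x]; last by rewrite !inE eqxx orbT.
split=> //=; first by rewrite ezy eyx.
case=> [|a [|b q]] //=; first by move=> _ zx; rewrite zx eqxx in nzx.
by rewrite andbT => eza ax; rewrite -ax eza in nezx.
Qed.

(** A vertex outside a clique resolves two of its members exactly when it is
    adjacent to only one of them. A vertex separating the closed neighbourhoods
    of two members of a clique is automatically outside the clique. *)
Lemma strong_resolving_setP (S : {set T}) :
  strong_resolving_set e S <-> reduced_clique (~: S).
Proof.
split=> [resS x y | redS x y nxy].
  rewrite !inE => Sx Sy nxy; have [z Sz res_z] := resS _ _ nxy.
  have nzx: z != x by apply: contraNneq Sx => <-.
  have nzy: z != y by apply: contraNneq Sy => <-.
  case: res_z => /shortest_path_midpoint; rewrite eq_sym => midz.
    case: midz => // [|ezy eyx nezx]; first by rewrite eq_sym.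
    rewrite e_sym eyx; apply/eqP => /setP/(_ z); rewrite !inE.
    by rewrite (negPf nzx) !(e_sym _ z) (negPf nezx) ezy orbT.
  case: midz => // ezx exy nezy.
  rewrite exy; apply/eqP => /setP/(_ z); rewrite !inE.
  by rewrite (negPf nzy) !(e_sym _ z) (negPf nezy) ezx orbT.
have [Sx | Sx] := boolP (x \in S).
  by exists x => //; apply: strongly_resolves_self.
have [Sy | Sy] := boolP (y \in S).
  exists y => //; suff [] : strongly_resolves e y y x by [right | left].
  by apply: strongly_resolves_self; rewrite eq_sym.
have /andP[exy nN] : e x y && (closed_nbhd x != closed_nbhd y).
  by apply: redS; rewrite ?inE.
(* [z] separates [u] from [v]; it then lies in [S] and [z, v, u] is a geodesic. *)
have sep u v z : u \notin S -> e u v -> z \in closed_nbhd v ->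
    z \notin closed_nbhd u ->
  z \in S /\ (exists2 p, shortest_path e z u p & v \in z :: p).
  rewrite !inE negb_or => Su euv vz /andP[nzu neuz].
  have nzv: z != v by apply: contraNneq neuz => ->.
  have evz: e v z by rewrite (negPf nzv) in vz.
  split.
    rewrite -[_ \in S]negbK; apply/negP => Sz.
    have := redS u z; rewrite !inE eq_sym => /(_ Su Sz nzu).
    by rewrite (negPf neuz).
  apply/shortest_path_midpoint=> //; first by rewrite eq_sym.
    by apply: contraTneq euv => ->; rewrite e_irr.
  by rewrite ![e z _]e_sym evz (e_sym v) euv.
have /exists_inP[z _ Nz] :
    [exists z in T, (z \in closed_nbhd x) != (z \in closed_nbhd y)].
  apply: contraR nN => /exists_inPn sameN; apply/eqP/setP => z.
  by apply/eqP; rewrite -[_ == _]negbK sameN.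
case xz: (z \in closed_nbhd x) Nz => /=; rewrite ?eqb_id ?eqbF_neg ?negbK => yz.
  have [||||Sz p] := sep y x z => //; first by rewrite e_sym.
  by exists z => //; right.
have [||||Sz p] := sep x y z => //; first by rewrite xz.
by exists z => //; left.
Qed.

Lemma sdimE (C : {set T}) :
    reduced_clique C -> (forall D, reduced_clique D -> #|D| <= #|C|) ->
  sdim e = #|T| - #|C|.
Proof.
move=> redC maxC; rewrite /sdim; case: arg_minnP => [|S].
  by apply/asboolP/strong_resolving_setP; rewrite setCT => u v; rewrite inE.
move=> /asboolP/strong_resolving_setP/maxC leSC /(_ (~: C)) minS.
have resC: strong_resolving_set e (~: C) by apply/strong_resolving_setP; rewrite setCK.
have {minS} := minS (asboolT resC).
rewrite -[in X in X -> _](addKn #|C| #|~: C|) cardsC => leS.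
apply/eqP; rewrite eqn_leq leS leq_subLR /=.
by rewrite -(cardsC S) addnC leq_add2r.
Qed.

End StrongResolving.
(** * Divisors of an integer *)

Definition bigomega (k : nat) : nat := \sum_(p <- primes k) logn p k.

Lemma bigomega_widen k B : 0 < k < B -> bigomega k = \sum_(p < B) logn p k.
Proof.
case/andP=> k_gt0 ltkB; rewrite /bigomega.
rewrite -(big_mkord xpredT (fun p => logn p k)) /=.
rewrite [RHS](bigID (mem (primes k))) /= [X in _ + X]big1 => [|p]; last first.
  by rewrite /= -logn_gt0 -eqn0Ngt => /eqP.
rewrite addn0 -[RHS]big_filter; apply: perm_big; apply: uniq_perm.
- exact: primes_uniq.
- by rewrite filter_uniq // iota_uniq.
move=> p; rewrite mem_filter mem_index_iota /= andb_idr // mem_primes.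
by case/and3P=> _ _ /(dvdn_leq k_gt0)/leq_ltn_trans->.
Qed.

Lemma bigomegaM a b :
  0 < a -> 0 < b -> bigomega (a * b) = bigomega a + bigomega b.
Proof.
move=> a_gt0 b_gt0; have ab_gt0: 0 < a * b by rewrite muln_gt0 a_gt0.
rewrite !(@bigomega_widen _ (a * b).+1) ?ab_gt0 ?a_gt0 ?b_gt0 //=.
- by rewrite -big_split; apply: eq_bigr => p _; rewrite lognM.
- by rewrite ltnS leq_pmull.
by rewrite ltnS leq_pmulr.
Qed.

Lemma bigomega1 : bigomega 1 = 0.
Proof. by rewrite /bigomega big_nil. Qed.

Lemma bigomega_prime p : prime p -> bigomega p = 1.
Proof. by move=> pr_p; rewrite /bigomega primes_prime // big_seq1 logn_prime ?eqxx. Qed.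

Lemma bigomega_gt0 k : 1 < k -> 0 < bigomega k.
Proof.
move=> k_gt1; have /dvdnP[m def_k] := pdiv_dvd k.
have := ltnW k_gt1; rewrite {1}def_k muln_gt0 => /andP[m_gt0 p_gt0].
by rewrite def_k bigomegaM // addn_gt0 (bigomega_prime (pdiv_prime k_gt1)) orbT.
Qed.

Lemma bigomega_dvd d m : 0 < m -> d %| m -> bigomega d <= bigomega m.
Proof.
move=> m_gt0 /dvdnP[q def_m].
move: m_gt0; rewrite def_m muln_gt0 => /andP[q_gt0 d_gt0].
by rewrite bigomegaM // leq_addl.
Qed.

Lemma bigomega_dvd_inj d m :
  0 < m -> d %| m -> bigomega d = bigomega m -> d = m.
Proof.
move=> m_gt0 /dvdnP[q def_m].
move: m_gt0; rewrite def_m muln_gt0 => /andP[q_gt0 d_gt0].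
rewrite bigomegaM // => /eqP; rewrite -[X in X == _]add0n eqn_add2r eq_sym => q0.
case: (ltngtP q 1) q_gt0 => // [q_gt1 _ | -> _]; last by rewrite mul1n.
by rewrite -leqn0 leqNgt bigomega_gt0 in q0.
Qed.

Definition prime_power (k : nat) : bool := size (primes k) == 1.

Lemma other_prime_divisor q k :
  1 < k -> ~~ prime_power k -> exists r, [/\ prime r, r %| k & r != q].
Proof.
move=> k_gt1 npp.
have [/allP all_q | /allPn[r]] := boolP (all (pred1 q) (primes k)); last first.
  by rewrite mem_primes => /and3P[pr_r _ rk] nrq; exists r.
case/negP: npp; rewrite /prime_power eqn_leq.
have -> : 0 < size (primes k).
  have: pdiv k \in primes k by rewrite mem_primes pdiv_prime // pdiv_dvd ltnW.
  by case: (primes k).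
rewrite andbT; apply: (@uniq_leq_size _ _ [:: q]); first exact: primes_uniq.
by move=> r /all_q; rewrite !inE.
Qed.

Lemma pnat_prime (q r d : nat) : q.-nat d -> prime r -> r %| d -> r = q.
Proof. by move=> qd pr_r /(pnat_dvd)/(_ qd); rewrite pnatE // => /eqP. Qed.

Lemma prime_power_pnat (p k : nat) : prime p -> prime_power k -> p %| k -> p.-nat k.
Proof.
move=> pr_p /eqP; rewrite /prime_power; case def_k: (primes k) => [|q []] // _ pk.
have k_gt0: 0 < k by case: k def_k {pk}.
have: p \in primes k by rewrite mem_primes pr_p k_gt0.
by rewrite /pnat k_gt0 def_k inE /= => /eqP->; rewrite inE eqxx.
Qed.

Definition comparable (a b : nat) : bool := (a %| b) || (b %| a).

Lemma incomparable_prime (q d r : nat) :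
  q.-nat d -> 1 < d -> prime r -> r != q -> ~~ comparable d r.
Proof.
move=> qd d_gt1 pr_r nrq; have rd: ~~ (r %| d).
  by apply: contra nrq => /(pnat_prime qd pr_r)->.
rewrite negb_or rd andbT; apply/negP => /(prime_nt_dvdP pr_r).
by rewrite neq_ltn d_gt1 orbT => /(_ isT) dr; rewrite dr dvdnn in rd.
Qed.

(** If [d] is a power of [q], take another prime divisor of [N]; otherwise take
    the full [p]-part of [N] for a prime [p] at which [d] falls short. *)
Lemma incomparable_divisor N d :
    ~~ prime_power N -> d %| N -> 1 < d < N ->
  exists2 m, m %| N & ~~ comparable d m.
Proof.
move=> npp dN /andP[d_gt1 ltdN]; have N_gt1 := ltn_trans d_gt1 ltdN.
have N_gt0 := ltnW N_gt1; have d_gt0 := ltnW d_gt1.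
have [qd | nqd] := boolP ((pdiv d).-nat d).
  have [r [pr_r rN nrq]] := other_prime_divisor (pdiv d) N_gt1 npp.
  by exists r => //; apply: incomparable_prime qd d_gt1 pr_r nrq.
case/dvdnP: dN => k def_N; have k_gt1: 1 < k.
  by move: ltdN; rewrite def_N -[X in X < _]mul1n ltn_pmul2r.
have pr_p := pdiv_prime k_gt1; set p := pdiv k in pr_p.
exists N`_p; rewrite ?dvdn_part // negb_or; apply/andP; split.
  apply: contra nqd => /pnat_dvd/(_ (part_pnat _ _)) pd.
  by rewrite (pnat_prime pd (pdiv_prime d_gt1) (pdiv_dvd d)).
rewrite p_part pfactor_dvdn // def_N lognM ?(ltnW k_gt1) // -ltnNge.
by rewrite -[X in X < _]add0n ltn_add2r logn_gt0 mem_primes pr_p (ltnW k_gt1) pdiv_dvd.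
Qed.

(** The pair [d = 1], [d' = N] is a real exception: both are comparable with
    every divisor of [N]. If [d = 1], a divisor incomparable with [d'] works. If
    [d'] is not a prime power, a divisor of [d'] incomparable with [d] works. *)
Lemma separating_divisor N d d' :
    0 < N -> ~~ prime_power N -> d %| d' -> d' %| N -> 0 < d < d' ->
    (1 < d) || (d' < N) ->
  exists2 m, m %| N & comparable d m != comparable d' m.
Proof.
move=> N_gt0 npp dd' d'N /andP[d_gt0 ltdd'] extr.
have d'_gt1: 1 < d' by apply: leq_ltn_trans ltdd'.
have d'_gt0 := ltnW d'_gt1.
have N_gt1: 1 < N := leq_trans d'_gt1 (dvdn_leq N_gt0 d'N).
have [d_gt1 | d_le1] := ltnP 1 d; last first.
  have d1: d = 1 by apply/eqP; rewrite eqn_leq d_le1.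
  rewrite d1 /= in extr; have [|m mN ncmp] := incomparable_divisor npp d'N.
    by rewrite d'_gt1.
  by exists m; rewrite // (negPf ncmp) d1 /comparable dvd1n.
have [pp | npp'] := boolP (prime_power d'); last first.
  have [|m md' ncmp] := incomparable_divisor npp' dd'; first by rewrite d_gt1.
  exists m; first exact: dvdn_trans md' d'N.
  by rewrite (negPf ncmp) /comparable md' orbT.
have pr_q := pdiv_prime d'_gt1; set q := pdiv d' in pr_q.
have qd': q.-nat d' by apply: prime_power_pnat; rewrite ?pdiv_dvd.
have [r [pr_r rN nrq]] := other_prime_divisor q N_gt1 npp.
have co_d'r: coprime d' r.
  by apply: (pnat_coprime qd'); rewrite pnatE // !inE.
(* [d] and [d'] are powers of [q]; [d * r] is a multiple of [d] only. *)
exists (d * r).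
  by rewrite Gauss_dvd ?(coprime_dvdl dd') // (dvdn_trans dd').
rewrite /comparable dvdn_mulr // eq_sym eqb_id.
rewrite negb_or Gauss_dvdl //; apply/andP; split; first by rewrite gtnNdvd.
apply/negP => /(dvdn_trans (dvdn_mull d (dvdnn r))) rd'.
by rewrite (pnat_prime qd' pr_r rd') eqxx in nrq.
Qed.

Lemma sigmaE k : sigma k = if prime_power k then 1 else bigomega k.
Proof. by []. Qed.

(** * Power graphs *)

Section PowerGraph.

Variable gT : finGroupType.
Local Open Scope group_scope.
Implicit Types u v w x : gT.
Local Notation pg := (@power_graph gT).
Local Notation nbhd := (closed_nbhd pg).

Lemma power_graph_irr : irreflexive pg.
Proof. by move=> u; rewrite /power_graph eqxx. Qed.

Lemma power_graph_sym : symmetric pg.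
Proof. by move=> u v; rewrite /power_graph eq_sym orbC. Qed.

Lemma power_graph_dom v : v != 1 -> pg 1 v.
Proof. by move=> nv1; rewrite /power_graph eq_sym nv1 group1. Qed.

Lemma in_nbhd u v : (v \in nbhd u) = (u \in <[v]>) || (v \in <[u]>).
Proof.
rewrite inE /power_graph eq_sym.
by case: eqP => [-> | _] //=; rewrite cycle_id.
Qed.

Lemma cycle_eq_nbhd u v : <[u]> = <[v]> -> nbhd u = nbhd v.
Proof.
by move=> eq_uv; apply/setP => w; rewrite !in_nbhd -(cycle_subG u) eq_uv cycle_subG.
Qed.

Lemma cycle_eq_order u v : u \in <[v]> -> #[u] = #[v] -> <[u]> = <[v]>.
Proof.
by move=> uv o_uv; apply/eqP; rewrite eqEcard cycle_subG uv -!orderE o_uv leqnn.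
Qed.

Lemma mem_cycle_dvd x u v :
  u \in <[x]> -> v \in <[x]> -> (u \in <[v]>) = (#[u] %| #[v]).
Proof.
move=> xu xv; rewrite -cycle_subG !orderE.
by rewrite (cardSg_cyclic (cycle_cyclic x)) ?cycle_subG.
Qed.

(** The number of prime factors of the order is injective on a reduced clique:
    of two adjacent elements one has order dividing that of the other, and equal
    numbers of prime factors make the two orders equal. *)
Lemma card_reduced_clique k (C : {set gT}) :
    reduced_clique pg C -> (forall u, bigomega #[u] <= k) -> #|C| <= k.+1.
Proof.
move=> redC le_k; pose f u : 'I_k.+1 := inord (bigomega #[u]).
have f_inj: {in C &, injective f}.
  move=> u v Cu Cv /(congr1 val); rewrite /f /= !inordK ?ltnS ?le_k // => eq_om.
  apply/eqP/negPn/negP => nuv; have /andP[/andP[_ adj]] := redC u v Cu Cv nuv.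
  case/eqP; case/orP: adj => [uv | vu].
    apply/cycle_eq_nbhd/cycle_eq_order => //.
    by apply: bigomega_dvd_inj => //; apply: order_dvdG.
  apply/esym/cycle_eq_nbhd/cycle_eq_order => //.
  by apply: bigomega_dvd_inj => //; apply: order_dvdG.
by rewrite -(card_in_imset f_inj) (leq_trans (max_card _)) ?card_ord.
Qed.

Definition cycle_chain (C : {set gT}) : Prop :=
  {in C &, forall u v, u != v ->
     (<[u]> \proper <[v]>) || (<[v]> \proper <[u]>)}.

(** Descend from [x] to [x ^+ p] for a prime divisor [p] of its order; each step
    removes one prime factor. *)
Lemma exists_cycle_chain x :
  exists C : {set gT},
    [/\ C \subset <[x]>, cycle_chain C & #|C| = (bigomega #[x]).+1].
Proof.
have [m] := ubnP #[x]; elim: m x => // m IHm x; rewrite ltnS => ox_le.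
have [x1 | nx1] := eqVneq x 1.
  exists [set 1]; split; first by rewrite sub1set group1.
    by move=> u v /set1P-> /set1P->; rewrite eqxx.
  by rewrite cards1 x1 order1 bigomega1.
have ox_gt1: 1 < #[x] by rewrite order_gt1.
have pr_p := pdiv_prime ox_gt1; set p := pdiv #[x] in pr_p.
have oxp: #[x ^+ p] = (#[x] %/ p)%N by rewrite orderXdiv ?pdiv_dvd.
have lt_oxp: #[x ^+ p] < #[x] by rewrite oxp ltn_Pdiv ?prime_gt1.
have [C [sCxp chC oC]] := IHm _ (leq_trans lt_oxp ox_le).
have sxp: <[x ^+ p]> \subset <[x]> by apply: cycleX.
have prC u : u \in C -> <[u]> \proper <[x]>.
  move=> /(subsetP sCxp); rewrite -cycle_subG => sxpu.
  rewrite properEcard (subset_trans sxpu sxp).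
  by apply: leq_ltn_trans (subset_leq_card sxpu) lt_oxp.
have notCx: x \notin C by apply/negP => /prC; rewrite properxx.
exists (x |: C); split.
- by rewrite subUset sub1set cycle_id (subset_trans sCxp).
- move=> u v /setU1P[-> | Cu] /setU1P[-> | Cv]; rewrite ?eqxx // => nuv.
  + by rewrite prC ?orbT.
  + by rewrite prC.
  exact: chC.
have def_ox: #[x] = (#[x ^+ p] * p)%N by rewrite oxp divnK ?pdiv_dvd.
rewrite cardsU1 notCx oC add1n [in RHS]def_ox.
by rewrite bigomegaM ?(prime_gt0 pr_p) // (bigomega_prime pr_p) addn1.
Qed.

(** In the subgraph on a cyclic group adjacency is divisibility of orders, so a
    separating divisor gives a separating vertex. *)
Lemma cyclic_nbhd_neq x u v :
    ~~ prime_power #[x] -> v \in <[x]> -> <[u]> \proper <[v]> ->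
  (u != 1) || (<[v]> != <[x]>) -> nbhd u != nbhd v.
Proof.
move=> npp xv pr_uv extr; have [suv _] := andP pr_uv.
have xu: u \in <[x]> by rewrite -cycle_subG (subset_trans suv) ?cycle_subG.
have svx: <[v]> \subset <[x]> by rewrite cycle_subG.
have cmpE g w : g \in <[x]> -> w \in <[x]> -> (w \in nbhd g) = comparable #[g] #[w].
  by move=> xg xw; rewrite in_nbhd (mem_cycle_dvd xg xw) (mem_cycle_dvd xw xg).
have [||||m mx] := @separating_divisor #[x] #[u] #[v] (order_gt0 x) npp.
- by rewrite order_dvdG // -cycle_subG.
- by rewrite order_dvdG.
- by rewrite order_gt0 /= !orderE proper_card.
- rewrite order_gt1; case/orP: extr => [-> // | nvx].
  by rewrite proper_card ?orbT // properEneq nvx.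
have m_gt0 : 0 < m by rewrite (dvdn_gt0 _ mx).
have om: #[x ^+ (#[x] %/ m)] = m.
  by rewrite orderXdiv ?dvdn_div // divnA // mulKn.
apply: contraNneq => eqN; have := cmpE v (x ^+ (#[x] %/ m)) xv (mem_cycle _ _).
by rewrite -eqN cmpE ?mem_cycle // om => ->.
Qed.

End PowerGraph.

(** * The generalized quaternion group *)

Section QuaternionModel.

Variable n : nat.
Hypothesis n_gt1 : 1 < n.
Import GRing.Theory.
Local Open Scope ring_scope.

Let N2 : (1 < 2 * n)%N.
Proof. by rewrite (@leq_trans (2 * 1)%N) // leq_mul2l ltnW. Qed.

Local Notation point := ('Z_(2 * n) * bool)%type.

(** The right regular representation: [(i, s)] stands for the element
    [x ^+ i * y ^+ s], and
    right multiplication by [y] sends [x ^+ i * y] to [x ^+ (i + n)]. *)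
Definition mulx (p : point) : point := (p.1 + (-1) ^+ p.2, p.2).
Definition muly (p : point) : point := (p.1 + n%:R *+ p.2, ~~ p.2).

Let natN : - n%:R = n%:R :> 'Z_(2 * n).
Proof. by apply/esym/eqP; rewrite -addr_eq0 -natrD addnn -mul2n pchar_Zp. Qed.

Lemma mulx_inj : injective mulx.
Proof.
case=> i s [j t] /eqP; rewrite /mulx xpair_eqE /= => /andP[eq_ij /eqP eq_st].
by move: eq_ij; rewrite eq_st => /eqP/addIr->.
Qed.

Lemma muly_inj : injective muly.
Proof.
case=> i s [j t] /eqP; rewrite /muly xpair_eqE /= => /andP[eq_ij /eqP/negb_inj eq_st].
by move: eq_ij; rewrite eq_st => /eqP/addIr->.
Qed.

Definition permx := perm mulx_inj.
Definition permy := perm muly_inj.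

Lemma permxX k i s : (permx ^+ k)%g (i, s) = (i + (-1) ^+ s *+ k, s) :> point.
Proof.
elim: k => [|k IHk]; first by rewrite expg0 perm1 mulr0n addr0.
by rewrite expgSr permM IHk permE /mulx /= mulrSr addrA.
Qed.

Lemma quaternion_model : <<[set permx; permy]>> \homg
  Grp (x : y : x ^+ n = y ^+ 2, x ^+ (2 * n) = 1, x ^ y = x^-1)%g.
Proof.
apply/existsP; exists (permx, permy); rewrite /= !xpair_eqE /=.
rewrite joing_idl joing_idr eqxx /=; apply/and3P; split; apply/eqP.
- apply/permP => -[i s]; rewrite permxX expgS expg1 permM !permE /muly /= negbK.
  by case: s => /=; rewrite ?mulNrn ?natN ?addr0.
- apply/permP => -[i s]; rewrite permxX perm1 mulrnA mulrnAC mulr2n.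
  have -> : (-1) ^+ s *+ n = n%:R :> 'Z_(2 * n).
    by case: s => /=; rewrite ?mulNrn ?natN.
  by rewrite -{1}natN addNr addr0.
have -> : (permx ^ permy = permy^-1 * (permx * permy))%g by rewrite /conjg mulgA.
apply/(canLR (mulKg _))/(mulIg permx); rewrite mulgKV.
apply/permP => -[i s]; rewrite !permM !permE /mulx /muly /= addrAC.
by rewrite -(addrA i) signrN addrN addr0.
Qed.

(** Evaluation at the point of the neutral element is onto, by [x ^+ i * y ^+ s]. *)
Lemma card_quaternion_model : (4 * n <= #|<<[set permx; permy]>>%g|)%N.
Proof.
have -> : (4 * n)%N = #|{: point}|.
  by rewrite card_prod card_bool card_ord (Zp_cast N2) mulnAC.
pose f (g : {perm point}) : point := g (0, false).
apply: leq_trans (leq_imset_card f _).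
apply: subset_leq_card; apply/subsetP => -[i s] _.
apply/imsetP; exists (permx ^+ i * permy ^+ s)%g.
  by rewrite groupM ?groupX ?mem_gen // !inE eqxx ?orbT.
rewrite /f permM permxX add0r expr0 natr_Zp.
by case: s; rewrite ?expg1 ?expg0 ?perm1 // permE /muly /= addr0.
Qed.

End QuaternionModel.

Section QuaternionStructure.

Local Open Scope group_scope.

(** The relations leave at most [4n] elements [x ^+ i] and [x ^+ i * y]; as the
    model is a quotient of the group, there are exactly [4n]. *)
Lemma quaternion_structure n (gT : finGroupType) :
    1 < n -> generalized_quaternion n gT ->
  exists x : gT,
    [/\ #[x] = (2 * n)%N, #|gT| = (4 * n)%N
      & forall w, w \notin <[x]> -> w ^+ 2 = x ^+ n].
Proof.
move=> n_gt1 isoQ.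
have cardQ: 4 * n <= #|gT|.
  apply: leq_trans (card_quaternion_model n_gt1) _; rewrite -cardsT.
  by apply: leq_homg; rewrite isoQ; apply: quaternion_model.
have /existsP[[x y]] := isoGrp_hom isoQ.
rewrite /= !xpair_eqE => /and4P[/eqP defG /eqP xn /eqP x2n /eqP xy].
have coverG w : (w \in <[x]>) || (w \in <[x]> :* y).
  have: w \in [set: gT] by rewrite inE.
  rewrite -defG norm_joinEr; last first.
    by rewrite cycle_subG; apply/normP; rewrite -cycleJ xy cycleV.
  case/mulsgP=> a _ xa /cycleP[j ->] ->.
  have y2x k : y ^+ k.*2 \in <[x]> by rewrite -mul2n expgM -xn -expgM mem_cycle.
  rewrite -(odd_double_half j) addnC expgD mulgA.
  case: (odd j); last by rewrite mulg1 groupM.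
  by apply/orP; right; rewrite expg1 mem_rcoset mulgK groupM.
have ox_le: #[x] <= 2 * n.
  by apply: dvdn_leq; [rewrite muln_gt0 (ltnW n_gt1) | rewrite order_dvdn x2n eqxx].
have card_le: #|gT| <= #[x] + #[x].
  rewrite orderE -{2}(card_rcoset <[x]> y) -cardsUI -cardsT.
  apply: leq_trans (leq_addr _ _).
  by apply: subset_leq_card; apply/subsetP => w _; rewrite inE.
have ox: #[x] = (2 * n)%N.
  apply/eqP; rewrite eqn_leq ox_le -(leq_pmul2l (ltn0Sn 1)) mulnA.
  by rewrite (leq_trans cardQ) // mul2n -addnn.
exists x; split=> //.
  apply/eqP; rewrite eqn_leq cardQ andbT (leq_trans card_le) //.
  by rewrite ox addnn -mul2n mulnA.
move=> w; have := coverG w; case: (w \in <[x]>) => //=.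
case/rcosetP=> _ /cycleP[i ->] -> _.
have conj_xi: (x ^+ i) ^ y = x ^- i by rewrite conjXg xy expgVn.
rewrite expgS expg1 [X in _ * X]conjgC conj_xi mulgA -(mulgA _ y y) -[y * y]/(y ^+ 2).
by rewrite -xn -expgD addnC expgD mulgK.
Qed.

End QuaternionStructure.

(** * Closed neighbourhoods in the power graph of the quaternion group *)

Section QuaternionPowerGraph.

Variables (n : nat) (gT : finGroupType) (x : gT).
Local Open Scope group_scope.
Hypothesis n_gt1 : 1 < n.
Hypothesis ox : #[x] = (2 * n)%N.
Hypothesis oG : #|gT| = (4 * n)%N.
Hypothesis outer_sqr : forall w, w \notin <[x]> -> w ^+ 2 = x ^+ n.

Implicit Types u v w : gT.
Local Notation pg := (@power_graph gT).
Local Notation nbhd := (closed_nbhd pg).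

Let n_gt0 : 0 < n. Proof. exact: ltnW. Qed.

Let ox_gt2 : 2 < #[x].
Proof. by rewrite ox (@leq_trans (2 * 2)%N) // leq_mul2l. Qed.

Lemma outer_order w : w \notin <[x]> -> #[w] = 4.
Proof.
move=> xw; have w2 := outer_sqr xw.
have ow4: #[w] %| 4.
  by rewrite order_dvdn (expgM w 2 2) w2 -expgM mulnC -ox expg_order.
have ow2: ~~ (#[w] %| 2).
  rewrite order_dvdn w2 -order_dvdn ox gtnNdvd // mul2n -addnn.
  by rewrite -[X in X < _]addn0 ltn_add2l.
by case: #[w] ow4 ow2 (@dvdn_leq _ 4 isT ow4) => [|[|[|[|[|k]]]]].
Qed.

Lemma outer_cycle u w :
  w \notin <[x]> -> u \in <[w]> -> 2 < #[u] -> <[u]> = <[w]>.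
Proof.
move=> xw wu ou_gt2; apply: cycle_eq_order => //.
have := order_dvdG wu; rewrite -orderE (outer_order xw) => ou4.
by case: #[u] ou4 ou_gt2 (@dvdn_leq _ 4 isT ou4) => [|[|[|[|[|k]]]]].
Qed.

(** An outer element adjacent to [u] would have [u] as a generator of its own
    cyclic subgroup, putting it in [<[u]>]. *)
Lemma nbhd_big_sub u : u \in <[x]> -> 2 < #[u] -> nbhd u \subset <[x]>.
Proof.
move=> xu ou_gt2; have sux: <[u]> \subset <[x]> by rewrite cycle_subG.
apply/subsetP => w; rewrite in_nbhd => /orP[wu | uw]; last exact: (subsetP sux).
apply/negPn/negP => xw; case/negP: (xw).
by rewrite -cycle_subG -(outer_cycle xw wu ou_gt2).
Qed.

(** The closed neighbourhood of [1] has [4n] elements, that of [u] at most [2n]. *)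
Lemma nbhd1_neq_big u : u \in <[x]> -> 2 < #[u] -> nbhd 1 != nbhd u.
Proof.
move=> xu ou_gt2; apply/eqP => eqN; have := nbhd_big_sub xu ou_gt2.
move/subset_leq_card; rewrite -eqN -orderE ox.
have -> : nbhd 1 = setT by apply/setP => w; rewrite in_nbhd group1 inE.
by rewrite cardsT oG leq_pmul2r.
Qed.

(** Outer elements have order 4, with two prime factors, which is no more than
    [2n] has since [n > 1]. *)
Lemma order_bigomega u : bigomega #[u] <= bigomega (2 * n).
Proof.
have [xu | xu] := boolP (u \in <[x]>).
  by apply: bigomega_dvd; rewrite ?muln_gt0 // -ox order_dvdG.
rewrite outer_order // (@bigomegaM 2 2) // bigomegaM // leq_add2l.
by rewrite bigomega_prime // bigomega_gt0.
Qed.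

(** A full chain of subgroups of [<[x]>]; its largest pair [1], [<[x]>] is
    separated by the outer elements, the other pairs inside [<[x]>]. *)
Lemma reduced_clique_not_prime_power : ~~ prime_power (2 * n) ->
  exists2 C : {set gT}, reduced_clique pg C & #|C| = (bigomega (2 * n)).+1.
Proof.
rewrite -ox => npp; have [C [sCx chC oC]] := exists_cycle_chain x.
exists C => // u v Cu Cv nuv; apply/andP; split.
  rewrite /power_graph nuv /=; case/orP: (chC u v Cu Cv nuv) => /proper_sub;
  by rewrite cycle_subG => ->; rewrite ?orbT.
have neq a b : b \in C -> <[a]> \proper <[b]> -> nbhd a != nbhd b.
  move=> Cb pr_ab; have xb := subsetP sCx b Cb.
  have [a1 | na1] := eqVneq a 1; last first.
    by apply: cyclic_nbhd_neq npp _ _ _; rewrite ?na1.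
  have [bx | nbx] := eqVneq <[b]> <[x]>; last first.
    by apply: cyclic_nbhd_neq npp _ _ _; rewrite ?nbx ?orbT.
  by rewrite a1 nbhd1_neq_big // orderE bx -orderE.
by case/orP: (chC u v Cu Cv nuv) => [/neq | /neq]; [|rewrite eq_sym]; apply.
Qed.

Section TwoGroup.

Hypothesis pp : prime_power (2 * n).

Lemma quaternion_2nat u : 2.-nat #[u].
Proof.
have pn: 2.-nat (2 * n)%N by apply: prime_power_pnat; rewrite ?dvdn_mulr.
have [xu | xu] := boolP (u \in <[x]>); last by rewrite outer_order.
by apply: pnat_dvd pn; rewrite -ox order_dvdG.
Qed.

(** Outer elements have order 4, so the involutions lie in the cyclic group
    [<[x]>], which has only one. *)
Lemma involution_in_cycle u w : #[u] = 2 -> w != 1 -> u \in <[w]>.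
Proof.
move=> ou nw1; have inner a : #[a] = 2 -> a \in <[x]>.
  by move=> oa; apply/negPn/negP => /outer_order; rewrite oa.
have w_even: 2 %| #[w].
  have ow_gt1: 1 < #[w] by rewrite order_gt1.
  by rewrite -(pnat_prime (quaternion_2nat w) (pdiv_prime ow_gt1)) ?pdiv_dvd.
have ot: #[w ^+ (#[w] %/ 2)] = 2.
  by rewrite orderXdiv ?dvdn_div // divnA // mulKn.
have: u \in <[w ^+ (#[w] %/ 2)]>.
  by rewrite (@mem_cycle_dvd _ x) ?inner // ou ot.
by apply/subsetP; apply: cycleX.
Qed.

Lemma nbhd_small u : #[u] <= 2 -> nbhd u = [set: gT].
Proof.
move=> ou_le2; apply/setP => w; rewrite in_nbhd inE.
have [-> | nw1] := eqVneq w 1; first by rewrite group1 orbT.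
have [-> | nu1] := eqVneq u 1; first by rewrite group1.
by rewrite involution_in_cycle //; apply/eqP; rewrite eqn_leq ou_le2 order_gt1.
Qed.

Lemma nbhd_big u : u \in <[x]> -> 2 < #[u] -> nbhd u = <[x]>.
Proof.
move=> xu ou_gt2; apply/eqP; rewrite eqEsubset nbhd_big_sub //=.
apply/subsetP => w xw; rewrite in_nbhd (mem_cycle_dvd xu xw) (mem_cycle_dvd xw xu).
have [[a ->] [b ->]] := (p_natP (quaternion_2nat u), p_natP (quaternion_2nat w)).
by rewrite !dvdn_Pexp2l // leq_total.
Qed.

(** Inside [<[x]>] both neighbourhoods are [<[x]>]; outside, [u] and [v] generate
    the same subgroup of order 4. *)
Lemma nbhd_big_eq u v : u \in <[v]> -> 2 < #[u] -> nbhd u = nbhd v.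
Proof.
move=> vu ou_gt2; have [xv | xv] := boolP (v \in <[x]>); last first.
  by apply: cycle_eq_nbhd; apply: outer_cycle.
have xu: u \in <[x]> by apply: (subsetP _ u vu); rewrite cycle_subG.
rewrite !nbhd_big // (leq_trans ou_gt2) // dvdn_leq //.
by rewrite -(@mem_cycle_dvd _ x).
Qed.

(** Two members cannot both have order at most 2, nor both have larger order. *)
Lemma card_reduced_clique_2group (C : {set gT}) : reduced_clique pg C -> #|C| <= 2.
Proof.
move=> redC; pose f u := 2 < #[u].
have f_inj: {in C &, injective f}.
  move=> u v Cu Cv eq_f; apply/eqP/negPn/negP => nuv.
  have /andP[/andP[_ adj]] := redC u v Cu Cv nuv.
  case/eqP; move: eq_f; rewrite /f; case: (ltnP 2 #[v]) => ov ou.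
    by case/orP: adj => [uv | vu]; [apply: nbhd_big_eq | apply/esym/nbhd_big_eq].
  by rewrite !nbhd_small // leqNgt ou.
by rewrite -(card_in_imset f_inj) (leq_trans (max_card _)) ?card_bool.
Qed.

Lemma reduced_clique_prime_power :
  exists2 C : {set gT}, reduced_clique pg C & #|C| = 2.
Proof.
have nx1: x != 1 by rewrite -order_gt1 ltnW.
have neq: nbhd 1 != nbhd x by rewrite nbhd1_neq_big ?cycle_id.
exists [set 1; x]; last by rewrite cards2 eq_sym nx1.
move=> u v /set2P[]-> /set2P[]->; rewrite ?eqxx // => _.
  by rewrite power_graph_dom.
by rewrite power_graph_sym power_graph_dom //= eq_sym.
Qed.

End TwoGroup.

End QuaternionPowerGraph.

Theorem mainTheorem6 (n : nat) (gT : finGroupType) :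
  2 <= n -> generalized_quaternion n gT ->
  sdim (@power_graph gT) = 4 * n - (sigma (2 * n) + 1).
Proof.
move=> n_gt1 /(quaternion_structure n_gt1)[x [ox oG outer_sqr]].
suff [C redC [oC maxC]] :
  exists2 C : {set gT}, reduced_clique (@power_graph gT) C &
    #|C| = sigma (2 * n) + 1 /\
    forall D : {set gT}, reduced_clique (@power_graph gT) D -> #|D| <= #|C|.
  rewrite -oC -oG; apply: (@sdimE _ _ 1%g) => //.
  - exact: power_graph_irr.
  - exact: power_graph_sym.
  exact: power_graph_dom.
rewrite sigmaE addn1; have [pp | npp] := boolP (prime_power (2 * n)).
  have [C redC oC] := reduced_clique_prime_power n_gt1 ox oG outer_sqr.
  exists C => //; rewrite oC; split=> // D.
  exact: (card_reduced_clique_2group n_gt1 ox outer_sqr pp).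
have [C redC oC] := reduced_clique_not_prime_power n_gt1 ox oG outer_sqr npp.
exists C => //; rewrite oC; split=> // D redD.
by apply: card_reduced_clique redD _ => u; apply: order_bigomega n_gt1 ox outer_sqr u.
Qed.
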